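(* Let $m\ge 1$, let $\lambda_1,\dots,\lambda_m\in\mathbb{R}$ and $n_1,\dots,n_m\in\mathbb{R}$, and define the cost $c_{ij}:=\lambda_i n_j$ for $1\le i,j\le m$. Define $$\mathbf{K}:=\min_{A}\left\{\sum_{i,j=1}^m a_{ij}\,\lambda_i n_j \;\middle|\; A=(a_{ij}) \text{ is an } m\times m \text{ doubly stochastic matrix}\right\}$$ and $$\mathbf{D}:=\sup_{\varphi,\psi\in\mathbb{R}^m}\left\{\sum_{i=1}^m(\varphi_i-\psi_i) \;\middle|\; \varphi_i-\psi_j\le \lambda_i n_j \text{ for all } 1\le i,j\le m\right\}.$$ Then $\mathbf{K}\ge\mathbf{D}$.
   Context: A real $m\times m$ matrix is doubly stochastic if all its entries are $\ge 0$ and the sum of the entries in each row and in each column equals $1$. The orbit setting: $\lambda_1,\dots,\lambda_m$ are the eigenvalues of a matrix $L=Q\lambda Q^*$ with $Q$ unitary and $\lambda=\mathrm{diag}(\lambda_1,\dots,\lambda_m)$, and $N=\mathrm{diag}(n_1,\dots,n_m)$; to such an $L$ one associates the matrix with entries $|Q_{ij}|^2$ and the total cost $\sum_{i,j}|Q_{ij}|^2\lambda_j n_i=\mathrm{Trace}(LN)$. *)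

(* Defs.v *)
From HB Require Import structures.
From mathcomp Require Import all_boot all_order all_algebra.
From mathcomp Require Import all_classical all_reals all_analysis.

Set Implicit Arguments.
Unset Strict Implicit.
Unset Printing Implicit Defensive.

Import Order.TTheory GRing.Theory Num.Theory.

Local Open Scope classical_set_scope.
Local Open Scope ring_scope.

Definition doubly_stochastic (R : realType) (m : nat) (A : 'M[R]_m) : Prop :=
  [/\ forall i j, 0 <= A i j,
      forall i, \sum_j A i j = 1
    & forall j, \sum_i A i j = 1].

Definition cost_matrix (R : realType) (m : nat) (l n : 'rV[R]_m) : 'M[R]_m :=
  \matrix_(i, j) (l 0 i * n 0 j).

Definition total_cost (R : realType) (m : nat) (c A : 'M[R]_m) : R :=
  \sum_i \sum_j A i j * c i j.

Definition dual_feasible (R : realType) (m : nat) (c : 'M[R]_m)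
    (phi psi : 'rV[R]_m) : Prop :=
  forall i j, phi 0 i - psi 0 j <= c i j.

Definition dual_objective (R : realType) (m : nat) (phi psi : 'rV[R]_m) : R :=
  \sum_i (phi 0 i - psi 0 i).

(* Both optimal values live in the extended reals, where infima and suprema   *)
(* are total and have no default value. That the infimum is a minimum is a    *)
(* separate assertion, [is_optimal_plan].                                     *)
Definition primal_value (R : realType) (m : nat) (c : 'M[R]_m) : \bar R :=
  ereal_inf [set (total_cost c A)%:E | A in @doubly_stochastic R m].

Definition is_optimal_plan (R : realType) (m : nat) (c A : 'M[R]_m) : Prop :=
  doubly_stochastic A /\ (total_cost c A)%:E = primal_value c.

Definition dual_value (R : realType) (m : nat) (c : 'M[R]_m) : \bar R :=
  ereal_sup [set (dual_objective p.1 p.2)%:E |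
              p in [set p : 'rV[R]_m * 'rV[R]_m | dual_feasible c p.1 p.2]].

(* Main.v *)
Require Import Defs.
From HB Require Import structures.
From mathcomp Require Import all_boot all_order all_algebra.
From mathcomp Require Import all_classical all_reals all_analysis.

Import Order.TTheory GRing.Theory Num.Theory.
Import numFieldTopology.Exports numFieldNormedType.Exports.

Local Open Scope classical_set_scope.
Local Open Scope ring_scope.

(** This is linear programming over the polytope of doubly stochastic matrices,
    for an arbitrary cost matrix [c].

    Attainment of the minimum is the extreme value theorem. The doubly
    stochastic matrices are cut out of the cube [[0, 1]^(m * m)] by closed
    conditions: entries are nonnegative, rows and columns sum to one. So they
    form a compact set ([compact_doubly_stochastic_vec]), nonempty because of
    the identity matrix, and the cost is linear in the entries.

    The inequality is weak duality ([weak_duality_pair]). Because the rows and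
    columns of a doubly stochastic [A] sum to one, the dual objective of
    [(phi, psi)] equals the sum of the differences [phi i - psi j] weighted by
    [A i j >= 0], and each difference is at most [c i j]. The supremum over the
    potentials and the infimum over the matrices preserve this bound. *)

Lemma continuous_sumr (R : realType) (T : topologicalType) (I : Type)
    (r : seq I) (F : I -> T -> R) :
  (forall i, continuous (F i)) -> continuous (fun x => \sum_(i <- r) F i x).
Proof. by move=> Fc; apply: continuous_big => //; exact: add_continuous. Qed.

Lemma continuous_vec_mx_entry (R : realType) (m n : nat) (i : 'I_m)
    (j : 'I_n) :
  continuous (fun v : 'rV[R]_(m * n) => vec_mx v i j).
Proof.
have -> : (fun v : 'rV[R]_(m * n) => vec_mx v i j) =
          (fun v : 'rV[R]_(m * n) => v 0 (mxvec_index i j)).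
  by apply/funext => v; rewrite mxE.
exact: coord_continuous.
Qed.

Lemma doubly_stochastic_le1 (R : realType) (m : nat) (A : 'M[R]_m) i j :
  doubly_stochastic A -> A i j <= 1.
Proof.
by case=> A0 Ar _; rewrite -(Ar i) (bigD1 j)//= lerDl sumr_ge0.
Qed.

Lemma doubly_stochastic1 (R : realType) (m : nat) :
  doubly_stochastic (1%:M : 'M[R]_m).
Proof.
split=> [i j|i|j].
- by rewrite mxE; case: (i == j).
- rewrite (bigD1 i)//= big1 ?addr0 ?mxE ?eqxx// => k /negPf ki.
  by rewrite mxE eq_sym ki.
- rewrite (bigD1 j)//= big1 ?addr0 ?mxE ?eqxx// => k /negPf kj.
  by rewrite mxE kj.
Qed.

(** The matrices are flattened by [mxvec] because the compactness of a product
    of segments (Tychonoff) is a statement about row vectors; the flattened set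
    is closed and, by [doubly_stochastic_le1], lies in a cube. *)
Lemma compact_doubly_stochastic_vec (R : realType) (m : nat) :
  compact [set v : 'rV[R]_(m * m) | doubly_stochastic (vec_mx v)].
Proof.
have cube : compact
    [set v : 'rV[R]_(m * m) | forall k, `[0, 1]%classic (v ord0 k)].
  by apply: (@rV_compact R _ (fun=> `[0, 1]%classic)) => _;
     exact: segment_compact.
apply: subclosed_compact cube _; last first.
  move=> v /= dsv k; case/mxvec_indexP: k => i j.
  rewrite /= in_itv/=.
  have -> : v ord0 (mxvec_index i j) = vec_mx v i j by rewrite mxE.
  by rewrite doubly_stochastic_le1// andbT; case: dsv.
have -> : [set v : 'rV[R]_(m * m) | doubly_stochastic (vec_mx v)] =
    (\bigcap_(p in [set: 'I_m * 'I_m])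
       (fun v : 'rV[R]_(m * m) => vec_mx v p.1 p.2) @^-1` [set x | 0 <= x]) `&`
    ((\bigcap_(i in [set: 'I_m])
       (fun v : 'rV[R]_(m * m) => \sum_j vec_mx v i j) @^-1` [set x | x = 1]) `&`
    (\bigcap_(j in [set: 'I_m])
       (fun v : 'rV[R]_(m * m) => \sum_i vec_mx v i j) @^-1` [set x | x = 1])).
  apply/seteqP; split=> v /=.
    by case=> v0 vr vc; split; [|split] => k _ /=.
  by case=> v0 [vr vc]; split=> [i j|i|j];
    [exact: (v0 (i, j))|exact: vr|exact: vc].
apply: closedI; [|apply: closedI]; apply: closed_bigI => k _.
- have /continuous_closedP := @continuous_vec_mx_entry R m m k.1 k.2.
  by apply; exact: closed_ge.
- have /continuous_closedP : continuous
      (fun v : 'rV[R]_(m * m) => \sum_j vec_mx v k j).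
    by apply: continuous_sumr => j; exact: continuous_vec_mx_entry.
  by apply; exact: closed_eq.
- have /continuous_closedP : continuous
      (fun v : 'rV[R]_(m * m) => \sum_i vec_mx v i k).
    by apply: continuous_sumr => i; exact: continuous_vec_mx_entry.
  by apply; exact: closed_eq.
Qed.

Lemma continuous_total_cost_vec (R : realType) (m : nat) (c : 'M[R]_m) :
  continuous (fun v : 'rV[R]_(m * m) => total_cost c (vec_mx v)).
Proof.
apply: continuous_sumr => i; apply: continuous_sumr => j v.
have entryc := @continuous_vec_mx_entry R m m i j v.
exact: (continuousM entryc (@cst_continuous _ _ (c i j) v)).
Qed.

Lemma exists_optimal_plan (R : realType) (m : nat) (c : 'M[R]_m) :
  exists A : 'M[R]_m, is_optimal_plan c A.
Proof.
have [|v /set_mem/= dsv vmin] := EVT_min_rV _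
    (@compact_doubly_stochastic_vec R m)
    (continuous_subspaceT (@continuous_total_cost_vec R m c)).
  by exists (mxvec 1%:M); rewrite /= mxvecK; exact: doubly_stochastic1.
exists (vec_mx v); split=> //; apply/eqP; rewrite eq_le; apply/andP; split.
- apply: le_ereal_inf_tmp => _ [A dsA <-]; rewrite lee_fin -[A]mxvecK.
  by apply: vmin; apply/mem_set; rewrite /= mxvecK.
- by apply: ereal_inf_lbound; exists (vec_mx v).
Qed.

(** Row sums turn [\sum_i phi i] into [\sum_i \sum_j A i j * phi i], column
    sums do the same for [psi], and feasibility is then applied termwise. *)
Lemma weak_duality_pair (R : realType) (m : nat) (c A : 'M[R]_m)
    (phi psi : 'rV[R]_m) :
  doubly_stochastic A -> dual_feasible c phi psi ->
  dual_objective phi psi <= total_cost c A.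
Proof.
move=> [A0 Ar Ac] feas.
have -> : dual_objective phi psi =
    \sum_i \sum_j A i j * (phi 0 i - psi 0 j).
  rewrite /dual_objective sumrB.
  under [RHS]eq_bigr => i _ do
    (under eq_bigr => j _ do rewrite mulrBr; rewrite sumrB).
  rewrite sumrB [in X in _ = _ - X]exchange_big/=; congr (_ - _).
  - by apply: eq_bigr => i _; rewrite -mulr_suml Ar mul1r.
  - by apply: eq_bigr => j _; rewrite -mulr_suml Ac mul1r.
by apply: ler_sum => i _; apply: ler_sum => j _; exact: ler_wpM2l.
Qed.

Lemma dual_value_le_primal_value (R : realType) (m : nat) (c : 'M[R]_m) :
  (dual_value c <= primal_value c)%E.
Proof.
apply: ge_ereal_sup => _ [[phi psi] /= feas <-].
apply: le_ereal_inf_tmp => _ [A dsA <-].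
by rewrite lee_fin; exact: weak_duality_pair.
Qed.

Theorem theorem2p9 (R : realType) (m : nat) (hm : (1 <= m)%N)
    (l n : 'rV[R]_m) :
  (exists A : 'M[R]_m, is_optimal_plan (cost_matrix l n) A) /\
  (dual_value (cost_matrix l n) <= primal_value (cost_matrix l n))%E.
Proof.
by split; [exact: exists_optimal_plan | exact: dual_value_le_primal_value].
Qed.
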